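(* Let $f:(0,+\infty)\to\mathbb{R}$ be a strictly monotonic and infinitely differentiable function, and let $M$ be the integral mean of the first kind associated with $f$, i.e. the mean satisfying $M(x,y)=f^{-1}\left(\frac{1}{y-x}\int_x^y f(t)\,dt\right)$ for all $x,y>0$ with $x\ne y$. Then $$Q_M=\frac{1}{12}\,\frac{f''}{f'}.$$
   Context: A mean is a function $M:(0,+\infty)^2\to(0,+\infty)$ of class $C^\infty$ such that $\min(x,y)\le M(x,y)\le\max(x,y)$ and $M(x,y)=M(y,x)$ for all $x,y>0$. In particular, the integral mean $M$ is by definition of class $C^\infty$. The characteristic function of a mean $M$ is $Q_M:(0,+\infty)\to\mathbb{R}$, $Q_M(x):=\frac{\partial^2 M}{\partial x^2}(x,x)$ (second partial derivative with respect to the first variable, evaluated at $(x,x)$). *)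

(* Defs.v *)
From Stdlib Require Import Reals ClassicalEpsilon.
From Coquelicot Require Import Coquelicot.
Open Scope R_scope.

(* Functions on (0,+oo) and (0,+oo)^2 are represented by total functions on R
   and R^2 of which only the values at positive arguments are constrained or
   used.  These domains are open, so the derivatives at their points do not
   depend on the values elsewhere. *)

Definition smooth_pos (f : R -> R) : Prop :=
  forall (n : nat) (x : R), 0 < x -> ex_derive_n f n x.

Definition smooth_pos2 (M : R -> R -> R) : Prop :=
  forall (n : nat) (x y : R), 0 < x -> 0 < y -> ex_diff_n M n x y.

Definition strictly_monotonic_pos (f : R -> R) : Prop :=
  (forall x y : R, 0 < x -> x < y -> f x < f y) \/
  (forall x y : R, 0 < x -> x < y -> f y < f x).

Record is_mean (M : R -> R -> R) : Prop := {
  mean_pos : forall x y : R, 0 < x -> 0 < y -> 0 < M x y;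
  mean_smooth : smooth_pos2 M;
  mean_between : forall x y : R, 0 < x -> 0 < y ->
    Rmin x y <= M x y <= Rmax x y;
  mean_sym : forall x y : R, 0 < x -> 0 < y -> M x y = M y x
}.

Definition charac (M : R -> R -> R) (x : R) : R := partial_derive 2 0 M x x.

(* The inverse of f : (0,+oo) -> R; unspecified outside the range of f. *)
Definition inv_pos (f : R -> R) (v : R) : R :=
  epsilon (inhabits 1) (fun z => 0 < z /\ f z = v).

(* The formula leaves out the diagonal, where being a mean forces M x x = x. *)
Definition integral_mean1 (f : R -> R) (M : R -> R -> R) : Prop :=
  is_mean M /\
  forall x y : R, 0 < x -> 0 < y -> x <> y ->
    M x y = inv_pos f (1 / (y - x) * RInt f x y).

(* Main.v *)
Require Import Defs.
From Stdlib Require Import Reals Lra ClassicalEpsilon.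
From Coquelicot Require Import Coquelicot.
Open Scope R_scope.

(** The formula for [Q_M] is the third order term of the expansion of the mean
    value identity [(t - a) f (M (t, a)) = RInt f a t] at [t = a].  Put
    [u t = f (M (t, a))].  Differentiating [(t - a) u t] three times and setting
    [t = a] leaves [3 u'' a], while the integral gives [f'' a]
    ([leibniz_third_order]).  On the other side the chain rule gives
    [u'' a = f'' a * (M_x (a, a))^2 + f' a * Q_M a].  A mean fixes the diagonal
    and is symmetric, so its two first partial derivatives at [(a, a)] are equal
    with sum [1] ([mean_derive1_diag]).  Hence [3 (f'' / 4 + f' Q_M) = f''],
    which is [f'' = 12 Q_M f'] ([charac_ode]).

    This identity is free of division, so it holds at every point, including a
    possible zero of [f'].  It excludes such zeros: [Q_M] is continuous because
    [M] is smooth, so [f'] solves a homogeneous linear differential equation and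
    would vanish identically if it vanished once ([linear_ode_zero]), making
    [f] constant although it is strictly monotonic.  The quotient [f'' / f'] is
    therefore meaningful and the formula follows. *)

(** * Calculus on the positive half-line *)

Lemma locally_pos (a : R) : 0 < a -> locally a (fun t : R => 0 < t).
Proof. intros ha; exact (open_gt 0 a ha). Qed.

Lemma is_derive_continuous (f : R -> R) (x l : R) :
  is_derive f x l -> continuous f x.
Proof. intros h; apply (ex_derive_continuous f x); now exists l. Qed.

Lemma is_derive_RInt_pos (f : R -> R) (a t : R) :
  (forall s, 0 < s -> continuous f s) -> 0 < a -> 0 < t ->
  is_derive (fun s => RInt f a s) t (f t).
Proof.
  intros hf ha ht.
  apply (is_derive_RInt f (fun s => RInt f a s) a t); [|now apply hf].
  generalize (locally_pos t ht); apply filter_imp; intros s hs.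
  apply (RInt_correct f), (ex_RInt_continuous f); intros z [hz _].
  apply hf; apply Rlt_le_trans with (2 := hz); now apply Rmin_glb_lt.
Qed.

(** Uniqueness for [u' = q u] by an integrating factor: if [I' = q], then
    [u exp (- I)] has derivative zero. *)
Lemma linear_ode_zero (u q : R -> R) (a : R) :
  (forall x, 0 < x -> is_derive u x (q x * u x)) ->
  (forall x, 0 < x -> continuous q x) ->
  0 < a -> u a = 0 -> forall x, 0 < x -> u x = 0.
Proof.
  intros hu hq ha hua x hx.
  assert (hex : exists I : R -> R, forall t, 0 < t -> is_derive I t (q t)).
  { exists (fun s => RInt q a s); intros t ht.
    now apply is_derive_RInt_pos. }
  destruct hex as [I hI].
  assert (hE : forall t, 0 < t ->
      is_derive (fun s => u s * exp (- I s)) t 0).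
  { intros t ht; assert (hu' := hu t ht); assert (hI' := hI t ht).
    auto_derive.
    - split; [now exists (q t * u t)|]; split; [now exists (q t)|easy].
    - rewrite (is_derive_unique (fun s : R => u s) t _ hu').
      rewrite (is_derive_unique (fun s : R => I s) t _ hI'); ring. }
  destruct (MVT_gen (fun s => u s * exp (- I s)) a x (fun _ => 0))
    as [c [_ hc]].
  - intros t [ht _]; apply hE.
    apply Rlt_trans with (2 := ht); now apply Rmin_glb_lt.
  - intros t [ht _]; apply derivable_continuous_pt; exists 0.
    apply is_derive_Reals, hE.
    apply Rlt_le_trans with (2 := ht); now apply Rmin_glb_lt.
  - rewrite hua in hc.
    assert (hexp := exp_pos (- I x)).
    apply (Rmult_eq_reg_r (exp (- I x))); lra.
Qed.

(** The difference quotient at [a] is [g] itself, so that continuity of [g]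
    suffices where the product rule would ask for a derivative.  This saves one
    order of differentiation in [leibniz_third_order]. *)
Lemma is_derive_mul_sub (g : R -> R) (a : R) :
  continuous g a -> is_derive (fun t => (t - a) * g t) a (g a).
Proof.
  intros hg; apply is_derive_Reals; intros eps heps.
  destruct (proj1 (filterlim_locally g (g a)) hg (mkposreal eps heps))
    as [d hd].
  exists d; intros h hh0 hhd.
  replace (((a + h - a) * g (a + h) - (a - a) * g a) / h - g a)
    with (g (a + h) - g a) by (field; exact hh0).
  apply (hd (a + h)).
  change (Rabs (a + h - a) < d); replace (a + h - a) with h by ring; exact hhd.
Qed.

(** Two differentiations of [(t - a) u t] give [2 u' + (t - a) u''] near [a], and
    the derivative of this at [a] is [2 u'' a + u'' a], by [is_derive_mul_sub]
    for the second term. *)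
Lemma leibniz_third_order (u u1 u2 f f1 : R -> R) (a f2 : R) :
  0 < a ->
  (forall t, 0 < t -> is_derive u t (u1 t)) ->
  (forall t, 0 < t -> is_derive u1 t (u2 t)) ->
  continuous u2 a ->
  (forall t, 0 < t -> is_derive (fun s => (s - a) * u s) t (f t)) ->
  (forall t, 0 < t -> is_derive f t (f1 t)) ->
  is_derive f1 a f2 ->
  3 * u2 a = f2.
Proof.
  intros ha hu hu1 hu2 hF hf hf1.
  assert (e1 : forall t, 0 < t -> u t + (t - a) * u1 t = f t).
  { intros t ht; rewrite <- (is_derive_unique _ _ _ (hF t ht)).
    symmetry; apply is_derive_unique.
    assert (h := hu t ht); auto_derive; [now exists (u1 t)|].
    rewrite (is_derive_unique (fun s : R => u s) t _ h); ring. }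
  assert (e2 : forall t, 0 < t -> 2 * u1 t + (t - a) * u2 t = f1 t).
  { intros t ht; rewrite <- (is_derive_unique _ _ _ (hf t ht)).
    symmetry; apply is_derive_unique.
    apply is_derive_ext_loc with (fun s => u s + (s - a) * u1 s).
    - generalize (locally_pos t ht); now apply filter_imp.
    - assert (h := hu t ht); assert (h1 := hu1 t ht); auto_derive.
      + split; [now exists (u1 t)|]; split; [now exists (u2 t)|easy].
      + rewrite (is_derive_unique (fun s : R => u s) t _ h).
        rewrite (is_derive_unique (fun s : R => u1 s) t _ h1); ring. }
  rewrite <- (is_derive_unique _ _ _ hf1).
  symmetry; apply is_derive_unique.
  apply is_derive_ext_loc with (fun t => 2 * u1 t + (t - a) * u2 t).
  - generalize (locally_pos a ha); now apply filter_imp.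
  - replace (3 * u2 a) with (2 * u2 a + u2 a) by ring.
    apply (is_derive_plus (fun t => 2 * u1 t) (fun t => (t - a) * u2 t)).
    + apply (is_derive_scal u1), (hu1 a ha).
    + now apply is_derive_mul_sub.
Qed.

(** * The mean value identity *)

(** The mean value theorem for the primitive of [f].  It shows that the choice
    made by [inv_pos] is meaningful at averages of [f]. *)
Lemma average_attained (f : R -> R) (x y : R) :
  (forall t, 0 < t -> continuous f t) -> 0 < x -> 0 < y -> x <> y ->
  exists z, 0 < z /\ f z = 1 / (y - x) * RInt f x y.
Proof.
  intros hf hx hy hxy.
  destruct (MVT_gen (fun s => RInt f x s) x y f) as [z [[hz _] hzv]].
  - intros t [ht _]; apply is_derive_RInt_pos; trivial.
    apply Rlt_trans with (2 := ht); now apply Rmin_glb_lt.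
  - intros t [ht _]; apply derivable_continuous_pt; exists (f t).
    apply is_derive_Reals, is_derive_RInt_pos; trivial.
    apply Rlt_le_trans with (2 := ht); now apply Rmin_glb_lt.
  - exists z; split.
    + apply Rlt_le_trans with (2 := hz); now apply Rmin_glb_lt.
    + rewrite (RInt_point x f) in hzv; change zero with 0 in hzv.
      replace (RInt f x y) with (f z * (y - x)) by lra.
      field; lra.
Qed.

(** Multiplying by [y - x] makes the defining formula valid on the diagonal too,
    where both sides vanish. *)
Lemma integral_mean1_spec (f : R -> R) (M : R -> R -> R) (x y : R) :
  (forall t, 0 < t -> continuous f t) -> integral_mean1 f M ->
  0 < x -> 0 < y -> (y - x) * f (M x y) = RInt f x y.
Proof.
  intros hf [_ hM] hx hy.
  destruct (Req_dec x y) as [<-|hxy].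
  - rewrite (RInt_point x f); change zero with 0; ring.
  - rewrite (hM x y hx hy hxy); unfold inv_pos.
    rewrite (proj2 (epsilon_spec (inhabits 1) _
               (average_attained f x y hf hx hy hxy))).
    field; lra.
Qed.

(** * Partial derivatives of a mean *)

Lemma mean_diag (M : R -> R -> R) (x : R) :
  is_mean M -> 0 < x -> M x x = x.
Proof.
  intros hM hx; assert (h := mean_between M hM x x hx hx).
  rewrite Rmin_left, Rmax_left in h; lra.
Qed.

Lemma smooth_pos2_derive1 (M : R -> R -> R) (x y : R) :
  smooth_pos2 M -> 0 < x -> 0 < y ->
  is_derive (fun t => M t y) x (partial_derive 1 0 M x y).
Proof.
  intros hM hx hy; apply Derive_correct.
  exact (proj1 (proj2 (hM 1%nat x y hx hy))).
Qed.

Lemma smooth_pos2_derive2 (M : R -> R -> R) (x y : R) :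
  smooth_pos2 M -> 0 < x -> 0 < y ->
  is_derive (fun t => partial_derive 1 0 M t y) x (partial_derive 2 0 M x y).
Proof.
  intros hM hx hy; apply Derive_correct.
  exact (ex_diff_n_ex_deriv_inf_1 2 1 0 (le_n 2) M x y
           (hM 2%nat x y hx hy)).
Qed.

Lemma smooth_pos2_continuous_partial (M : R -> R -> R) (n : nat) (x y : R) :
  smooth_pos2 M -> 0 < x -> 0 < y ->
  continuous (fun p : R * R => partial_derive n 0 M (fst p) (snd p)) (x, y).
Proof.
  intros hM hx hy; apply continuity_2d_pt_filterlim.
  assert (h := ex_diff_n_deriv n n 0 ltac:(rewrite <- plus_n_O; apply le_n)
                 M x y (hM n x y hx hy)).
  destruct (n - (n + 0))%nat in h; exact (proj1 h).
Qed.

(** By symmetry both first partial derivatives at [(a, a)] are equal, and by the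
    chain rule along the diagonal, where [M (t, t) = t], they add up to [1]. *)
Lemma mean_derive1_diag (M : R -> R -> R) (a : R) :
  is_mean M -> 0 < a -> partial_derive 1 0 M a a = 1 / 2.
Proof.
  intros hM ha.
  assert (hy : is_derive (fun t => M a t) a (partial_derive 1 0 M a a)).
  { apply is_derive_ext_loc with (fun t => M t a).
    - generalize (locally_pos a ha); apply filter_imp; intros t ht.
      now apply (mean_sym M hM).
    - apply smooth_pos2_derive1; trivial; now apply mean_smooth. }
  assert (hd : differentiable_pt_lim M a a
                 (partial_derive 1 0 M a a) (partial_derive 1 0 M a a)).
  { apply filterdiff_differentiable_pt_lim.
    apply (is_derive_filterdiff M a a (partial_derive 1 0 M)); trivial.
    - destruct (locally_pos a ha) as [d hdp]; exists d.
      intros [u v] [hu hv]; apply smooth_pos2_derive1;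
        [now apply mean_smooth | now apply hdp | now apply hdp].
    - apply smooth_pos2_continuous_partial; trivial; now apply mean_smooth. }
  assert (hc := derivable_pt_lim_comp_2d M (fun t => t) (fun t => t) a _ _ 1 1
                  hd (derivable_pt_lim_id a) (derivable_pt_lim_id a)).
  apply is_derive_Reals, is_derive_unique in hc.
  assert (h1 : Derive (fun t => M t t) a = 1).
  { apply is_derive_unique, is_derive_ext_loc with (fun t => t).
    - generalize (locally_pos a ha); apply filter_imp; intros t ht.
      symmetry; now apply mean_diag.
    - apply (is_derive_id a). }
  rewrite h1 in hc; lra.
Qed.

Lemma charac_continuous (M : R -> R -> R) (a : R) :
  is_mean M -> 0 < a -> continuous (charac M) a.
Proof.
  intros hM ha.
  apply (continuous_comp_2 (fun t : R => t) (fun t : R => t)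
           (partial_derive 2 0 M)).
  - apply continuous_id.
  - apply continuous_id.
  - apply smooth_pos2_continuous_partial; trivial; now apply mean_smooth.
Qed.

(** * The differential equation for the derivative *)

(** Stated without a quotient, so that it also holds where [f'] might vanish;
    this is what makes it usable to prove that [f'] has no zero. *)
Lemma charac_ode (f : R -> R) (M : R -> R -> R) (a : R) :
  smooth_pos f -> integral_mean1 f M -> 0 < a ->
  Derive_n f 2 a = 12 * charac M a * Derive f a.
Proof.
  intros hf hM ha; assert (hm := proj1 hM).
  assert (df : forall n t, 0 < t ->
             is_derive (Derive_n f n) t (Derive_n f (S n) t)).
  { intros n t ht; apply Derive_correct, (hf (S n) t ht). }
  assert (cf : forall n t, 0 < t -> continuous (Derive_n f n) t).
  { intros n t ht; exact (is_derive_continuous _ _ _ (df n t ht)). }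
  assert (hpos : forall t, 0 < t -> 0 < M t a).
  { intros t ht; now apply (mean_pos M hm). }
  set (m1 := partial_derive 1 0 M); set (m2 := partial_derive 2 0 M).
  set (u1 := fun t => Derive_n f 1 (M t a) * m1 t a).
  set (u2 := fun t => Derive_n f 2 (M t a) * m1 t a ^ 2
                      + Derive_n f 1 (M t a) * m2 t a).
  assert (dm : forall t, 0 < t -> is_derive (fun s => M s a) t (m1 t a)).
  { intros t ht; apply smooth_pos2_derive1; trivial; now apply mean_smooth. }
  assert (dm1 : forall t, 0 < t -> is_derive (fun s => m1 s a) t (m2 t a)).
  { intros t ht; apply smooth_pos2_derive2; trivial; now apply mean_smooth. }
  assert (dfm : forall n t, 0 < t -> is_derive (fun s => Derive_n f n (M s a)) t
             (m1 t a * Derive_n f (S n) (M t a))).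
  { intros n t ht; apply (is_derive_comp (Derive_n f n) (fun s => M s a)).
    - now apply df, hpos.
    - now apply dm. }
  assert (h3 : 3 * u2 a = Derive_n f 2 a).
  { apply (leibniz_third_order (fun t => f (M t a)) u1 u2 f (Derive_n f 1));
      trivial.
    - intros t ht; unfold u1; rewrite Rmult_comm; now apply (dfm 0%nat).
    - intros t ht; unfold u1, u2.
      replace (_ + _) with ((m1 t a * Derive_n f 2 (M t a)) * m1 t a
                  + Derive_n f 1 (M t a) * m2 t a) by ring.
      apply (is_derive_mult (fun s => Derive_n f 1 (M s a)) (fun s => m1 s a)).
      + now apply (dfm 1%nat).
      + now apply dm1.
      + intros; apply Rmult_comm.
    - assert (c2 : continuous (fun t => m2 t a) a).
      { apply (continuous_comp_2 (fun t : R => t) (fun _ : R => a) m2).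
        - apply continuous_id.
        - apply continuous_const.
        - apply smooth_pos2_continuous_partial; trivial; now apply mean_smooth. }
      assert (cm1 : continuous (fun t => m1 t a) a)
        by exact (is_derive_continuous _ _ _ (dm1 a ha)).
      assert (cfm : forall n, continuous (fun t => Derive_n f n (M t a)) a)
        by (intros n; exact (is_derive_continuous _ _ _ (dfm n a ha))).
      apply (continuous_plus (fun t => Derive_n f 2 (M t a) * m1 t a ^ 2)
               (fun t => Derive_n f 1 (M t a) * m2 t a)).
      + apply (continuous_mult (fun t => Derive_n f 2 (M t a))); trivial.
        apply (continuous_mult (fun t => m1 t a) (fun t => m1 t a * 1)); trivial.
        apply (continuous_mult (fun t => m1 t a) (fun _ => 1)); trivial.
        apply continuous_const.
      + now apply (continuous_mult (fun t => Derive_n f 1 (M t a))).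
    - intros t ht.
      apply is_derive_ext_loc with (fun s => RInt f a s).
      + generalize (locally_pos t ht); apply filter_imp; intros s hs.
        rewrite (mean_sym M hm s a hs ha); symmetry.
        apply integral_mean1_spec; trivial; exact (cf 0%nat).
      + apply is_derive_RInt_pos; trivial; exact (cf 0%nat).
    - exact (df 0%nat).
    - now apply (df 1%nat). }
  unfold u2, m1, m2 in h3.
  rewrite (mean_diag M a hm ha), (mean_derive1_diag M a hm ha) in h3.
  change (Derive_n f 1 a) with (Derive f a) in h3.
  unfold charac; lra.
Qed.

Theorem proposition3p23 (f : R -> R) (M : R -> R -> R)
    (hmono : strictly_monotonic_pos f) (hsmooth : smooth_pos f)
    (hM : integral_mean1 f M) :
  forall x : R, 0 < x ->
    Derive f x <> 0 /\
    charac M x = 1 / 12 * (Derive_n f 2 x / Derive f x).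
Proof.
  intros x hx.
  assert (hne : Derive f x <> 0).
  { intros h0.
    assert (hz : forall t, 0 < t -> Derive f t = 0).
    { apply (linear_ode_zero (Derive f) (fun t => 12 * charac M t) x);
        trivial.
      - intros t ht; rewrite <- (charac_ode f M t hsmooth hM ht).
        apply Derive_correct, (hsmooth 2%nat t ht).
      - intros t ht; apply (continuous_scal_r 12 (charac M)).
        apply charac_continuous; trivial; exact (proj1 hM). }
    assert (h12 : f 1 = f 2).
    { apply eq_is_derive; [|lra]; intros t ht.
      change (is_derive f t 0); rewrite <- (hz t) by lra.
      apply Derive_correct, (hsmooth 1%nat t); lra. }
    destruct hmono as [h|h]; specialize (h 1 2 ltac:(lra) ltac:(lra)); lra. }
  split; trivial.
  rewrite (charac_ode f M x hsmooth hM hx); field; exact hne.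
Qed.
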